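(* Let $m\geq2$, $u=4t/(1+t)^{2}$, $z=(1+t)x/(1-t)$, and \[ d_{m,j,k}=\sum_{l=0}^{k}{l+jm \choose l}{jm \choose k-l},\qquad d_{m,j,k}^{\prime}=\sum_{l=0}^{k}{l+jm+1 \choose l}{jm+1 \choose k-l}. \] Then (a) \[ \frac{1}{1-t}\sum_{n=0}^{\infty}P_{12\cdots m,n}^{\mathrm{ilpk}}(s,u)z^{n}=\sum_{n=0}^{\infty}\Bigg(\frac{z}{1-t}+\frac{(s-1)z^{m}}{(1-t)(1-(s-1)\sum_{l=1}^{m-1}z^{l})}\Bigg)^{*\langle n\rangle}, \] (b) \[ \frac{1}{1-t}\sum_{n=0}^{\infty}P_{12\cdots m,n}^{\mathrm{ilpk}}(u)z^{n}=\sum_{n=0}^{\infty}\left(\frac{z(1-z^{m-1})}{(1-t)(1-z^{m})}\right)^{*\langle n\rangle}, \] and (c) \[ \frac{1}{1-t}\sum_{n=0}^{\infty}P_{12\cdots m,n}^{\mathrm{ilpk}}(u)z^{n}=\sum_{k=0}^{\infty}\left[\sum_{j=0}^{\infty}(d_{m,j,k}x^{jm}-d_{m,j,k}^{\prime}x^{jm+1})\right]^{-1}t^{k}. \]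
   Context: $\mathfrak{S}_n$ is the set of permutations of $[n]$ in one-line notation ($\mathfrak{S}_0$ = empty permutation). $\operatorname{std}$ of a sequence of distinct integers replaces its letters by $1,2,\dots$ in order of size. For $\pi\in\mathfrak{S}_n$ and $\sigma\in\mathfrak{S}_m$, $\operatorname{occ}_\sigma(\pi)$ is the number of $i\in[n-m+1]$ with $\operatorname{std}(\pi_i\cdots\pi_{i+m-1})=\sigma$. A left peak of $\pi$ is $i\in\{2,\dots,n-1\}$ with $\pi_{i-1}<\pi_i>\pi_{i+1}$, or $i=1$ if $n\ge2$ and $\pi_1>\pi_2$; $\operatorname{lpk}$ counts left peaks and $\operatorname{ilpk}(\pi)=\operatorname{lpk}(\pi^{-1})$. $P_{\sigma,n}^{\mathrm{ilpk}}(s,t)=\sum_{\pi\in\mathfrak{S}_n}s^{\operatorname{occ}_\sigma(\pi)}t^{\operatorname{ilpk}(\pi)}$ for $n\ge1$, $=1$ for $n=0$, and $P_{\sigma,n}^{\mathrm{ilpk}}(t)=P_{\sigma,n}^{\mathrm{ilpk}}(0,t)$. In (a),(b) the right sides are computed in formal power series with ordinary multiplication in $s,x$ and the Hadamard product in $t$: $(\sum_n a_nt^n)*(\sum_n b_nt^n)=\sum_n a_nb_nt^n$; $f^{*\langle n\rangle}$ is the $n$-fold Hadamard product, $f^{*\langle0\rangle}=1/(1-t)$. In (c), $[\cdot]^{-1}$ is the ordinary inverse in $\mathbb{Q}[[x]]$. Other expressions use ordinary multiplication. *)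

(* Defs.v *)
From HB Require Import structures.
From mathcomp Require Import all_boot all_order all_algebra all_fingroup.
From mathcomp Require Import boolp classical_sets.

Set Implicit Arguments.
Unset Strict Implicit.
Unset Printing Implicit Defensive.

Import GRing.Theory.
Local Open Scope ring_scope.

Record fps (T : Type) := Fps { fcoef :> nat -> T }.

Notation "{ 'fps' T }" := (fps T) (format "{ 'fps'  T }") : type_scope.

HB.instance Definition _ (T : Type) := gen_eqMixin {fps T}.
HB.instance Definition _ (T : Type) := gen_choiceMixin {fps T}.

Lemma fpsP (T : Type) (f g : {fps T}) : f =1 g <-> f = g.
Proof.
split=> [|-> //]; case: f g => [f] [g] /= fg.
by congr Fps; apply/funext.
Qed.

Section FpsZmod.
Variable R : zmodType.
Implicit Types f g h : {fps R}.

Definition fps_zero : {fps R} := Fps (fun=> 0).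
Definition fps_add f g : {fps R} := Fps (fun n => f n + g n).
Definition fps_opp f : {fps R} := Fps (fun n => - f n).

Fact fps_addA : associative fps_add.
Proof. by move=> f g h; apply/fpsP => n /=; rewrite addrA. Qed.

Fact fps_addC : commutative fps_add.
Proof. by move=> f g; apply/fpsP => n /=; rewrite addrC. Qed.

Fact fps_add0 : left_id fps_zero fps_add.
Proof. by move=> f; apply/fpsP => n /=; rewrite add0r. Qed.

Fact fps_addN : left_inverse fps_zero fps_opp fps_add.
Proof. by move=> f; apply/fpsP => n /=; rewrite addNr. Qed.

HB.instance Definition _ :=
  GRing.isZmodule.Build {fps R} fps_addA fps_addC fps_add0 fps_addN.

Lemma fcoef0 n : (0 : {fps R}) n = 0. Proof. by []. Qed.
Lemma fcoefD f g n : (f + g) n = f n + g n. Proof. by []. Qed.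
Lemma fcoefN f n : (- f) n = - f n. Proof. by []. Qed.
Lemma fcoefB f g n : (f - g) n = f n - g n. Proof. by []. Qed.

Lemma fcoef_sum (I : Type) (r : seq I) (P : pred I) (F : I -> {fps R}) n :
  (\sum_(i <- r | P i) F i) n = \sum_(i <- r | P i) F i n.
Proof. by elim/big_rec2: _ => // i x y _ <-. Qed.

Definition fpsC (c : R) : {fps R} := Fps (fun n => if n is 0%N then c else 0).
End FpsZmod.

Section FpsRing.
Variable R : comNzRingType.
Implicit Types f g h : {fps R}.

Definition fps_mul f g : {fps R} :=
  Fps (fun n => \sum_(i < n.+1) f i * g (n - i)%N).

Fact fps_mulC : commutative fps_mul.
Proof.
move=> f g; apply/fpsP => n /=; rewrite (reindex_inj rev_ord_inj) /=.
by apply: eq_bigr => i _; rewrite mulrC subSS subKn // -ltnS.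
Qed.

Fact fps_mulA : associative fps_mul.
Proof.
have rev f g n : fps_mul f g n = \sum_(i < n.+1) f (n - i)%N * g i.
  by rewrite fps_mulC /=; apply: eq_bigr => i _; rewrite mulrC.
move=> p q r; apply/fpsP => i; rewrite [RHS]rev.
pose coef3 j k := p j * (q (i - j - k)%N * r k).
transitivity (\sum_(j < i.+1) \sum_(k < i.+1 | (k <= i - j)%N) coef3 j k).
  rewrite /fps_mul /=; apply: eq_bigr => /= j _.
  have := rev q r (i - j)%N; rewrite /= => ->.
  by rewrite big_distrr /= (big_ord_narrow_leq (leq_subr _ _)).
rewrite (exchange_big_dep predT) //=; apply: eq_bigr => k _.
transitivity (\sum_(j < i.+1 | (j <= i - k)%N) coef3 j k).
  apply: eq_bigl => j; rewrite -ltnS -(ltnS j) -!subSn ?leq_ord //.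
  by rewrite -subn_gt0 -(subn_gt0 j) -!subnDA addnC.
rewrite (big_ord_narrow_leq (leq_subr _ _)) big_distrl /=.
by apply: eq_bigr => j _; rewrite /coef3 -!subnDA addnC mulrA.
Qed.

Fact fps_mul1 : left_id (fpsC 1) fps_mul.
Proof.
move=> f; apply/fpsP => n /=; rewrite big_ord_recl /= subn0 mul1r big1 ?addr0//.
by move=> i _; rewrite mul0r.
Qed.

Fact fps_mulDl : left_distributive fps_mul +%R.
Proof.
move=> f g h; apply/fpsP => n /=; rewrite -big_split.
by apply: eq_bigr => i _; rewrite mulrDl.
Qed.

Fact fps_1neq0 : fpsC 1 != 0 :> {fps R}.
Proof. by apply/eqP => /fpsP /(_ 0%N) /eqP; rewrite /= oner_eq0. Qed.

HB.instance Definition _ := GRing.Zmodule_isComNzRing.Build {fps R}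
  fps_mulA fps_mulC fps_mul1 fps_mulDl fps_1neq0.

Lemma fcoef1 n : (1 : {fps R}) n = (n == 0%N)%:R.
Proof. by case: n. Qed.

Lemma fcoefM f g n : (f * g) n = \sum_(i < n.+1) f i * g (n - i)%N.
Proof. by []. Qed.

Lemma fcoef0M f g : (f * g) 0%N = f 0%N * g 0%N.
Proof. by rewrite fcoefM big_ord_recl big_ord0 addr0. Qed.

Lemma fcoefCM c f n : (fpsC c * f) n = c * f n.
Proof.
rewrite fcoefM big_ord_recl /= subn0 big1 ?addr0 //.
by move=> i _; rewrite mul0r.
Qed.

Lemma fcoefX_lt f k n : f 0%N = 0 -> (n < k)%N -> (f ^+ k) n = 0.
Proof.
move=> f0; elim: k n => // k IHk n; rewrite ltnS => nk.
rewrite exprS fcoefM big_ord_recl f0 mul0r add0r big1 // => i _ /=.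
by rewrite IHk ?mulr0 // (leq_trans _ nk) // /bump /=; case: i => i /= ?;
   rewrite add1n -subn_gt0 subKn //.
Qed.

Definition fpsX : {fps R} := Fps (fun n => (n == 1%N)%:R).

Definition hadamard f g : {fps R} := Fps (fun n => f n * g n).
End FpsRing.

Section FpsUnitRing.
Variable R : comUnitRingType.
Implicit Types f g h : {fps R}.

Definition fps_unit : {pred {fps R}} :=
  [pred f : {fps R} | f 0%N \is a GRing.unit].

(* Geometric series: with c = f_0 and f = c (1 - h), the coefficient of order n
   of f^-1 = c^-1 (1 + h + h^2 + ...) only involves the powers up to n. *)
Definition fps_inv f : {fps R} :=
  if f \in fps_unit then
    let c' := (f 0%N)^-1 in
    let h := 1 - fpsC c' * f in
    Fps (fun n => c' * (\sum_(k < n.+1) h ^+ k) n)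
  else f.

Fact fps_mulVx : {in fps_unit, left_inverse 1 fps_inv *%R}.
Proof.
move=> f fU; rewrite mulrC /fps_inv fU; set c' := _^-1; set h := 1 - _.
have cU : f 0%N \is a GRing.unit by [].
have h0 : h 0%N = 0 by rewrite /h fcoefB fcoefCM fcoef1 /= /c' mulVr ?subrr.
have fE : fpsC c' * f = 1 - h by rewrite /h opprB addrC subrK.
have sumE N n : (n <= N)%N ->
    (\sum_(k < n.+1) h ^+ k) n = (\sum_(k < N.+1) h ^+ k) n.
  move=> nN; have nN' : (n.+1 <= N.+1)%N by [].
  rewrite !fcoef_sum (big_ord_widen _ (fun k => (h ^+ k) n) nN').
  rewrite [RHS](bigID (fun k : 'I_ _ => (k < n.+1)%N)) /=.
  rewrite [X in _ = _ + X]big1 ?addr0 // => k.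
  by rewrite -leqNgt => nk; rewrite fcoefX_lt.
apply/fpsP => n.
transitivity ((fpsC c' * f * \sum_(k < n.+1) h ^+ k) n).
  rewrite -mulrA fcoefCM !fcoefM big_distrr /=.
  apply: eq_bigr => i _; rewrite mulrCA; congr (_ * (_ * _)).
  by rewrite (sumE n) // leq_subr.
rewrite fE -opprB mulNr -subrX1 opprB fcoefB fcoefX_lt ?subr0 //.
Qed.

Fact fps_unitPl f g : g * f = 1 -> f \in fps_unit.
Proof.
move=> /fpsP /(_ 0%N); rewrite fcoef0M fcoef1 /= => gf.
by rewrite inE; apply/unitrPr; exists (g 0%N); rewrite mulrC.
Qed.

Fact fps_inv_out : {in [predC fps_unit], fps_inv =1 id}.
Proof. by move=> f; rewrite inE /fps_inv => /negbTE ->. Qed.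

HB.instance Definition _ := GRing.ComNzRing_hasMulInverse.Build {fps R}
  fps_mulVx fps_unitPl fps_inv_out.

Lemma fps_unitE f : (f \is a GRing.unit) = (f 0%N \is a GRing.unit).
Proof. by []. Qed.

(* The unit of the Hadamard product is 1/(1-t), hence the 0-th power. *)
Definition hadamard_exp f n : {fps R} :=
  iter n (hadamard f) (1 - fpsX R)^-1.
End FpsUnitRing.

(* Formal convergence: sequences in the base ring converge when they are
   eventually constant, and sequences of formal power series converge when all
   their coefficients do. *)
HB.mixin Record hasFormalLimit T := {
  is_flim : (nat -> T) -> T -> Prop;
  is_flim_unique : forall a l l', is_flim a l -> is_flim a l' -> l = l'
}.

#[short(type="flimType")]
HB.structure Definition FormalLimit := { T of hasFormalLimit T }.

#[short(type="flimZmodType")]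
HB.structure Definition FormalLimitZmodule :=
  { T of GRing.Zmodule T & hasFormalLimit T }.

Definition eventually_const (T : Type) (a : nat -> T) (l : T) : Prop :=
  exists N, forall n, (N <= n)%N -> a n = l.

Fact eventually_const_unique (T : Type) (a : nat -> T) (l l' : T) :
  eventually_const a l -> eventually_const a l' -> l = l'.
Proof.
by move=> [N aN] [N' aN']; rewrite -(aN (maxn N N')) ?leq_maxl // aN' ?leq_maxr.
Qed.

HB.instance Definition _ :=
  hasFormalLimit.Build rat (@eventually_const_unique rat).

Section FpsLimit.
Variable T : flimType.

Definition fps_is_flim (a : nat -> {fps T}) (l : {fps T}) : Prop :=
  forall k, is_flim (fun n => a n k) (l k).

Fact fps_is_flim_unique (a : nat -> {fps T}) (l l' : {fps T}) :
  fps_is_flim a l -> fps_is_flim a l' -> l = l'.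
Proof. by move=> al al'; apply/fpsP => k; apply: is_flim_unique (al k) (al' k). Qed.

HB.instance Definition _ := hasFormalLimit.Build {fps T} fps_is_flim_unique.
End FpsLimit.

HB.instance Definition _ (T : flimZmodType) := FormalLimit.on {fps T}.

Section FormalSum.
Variable V : flimZmodType.
Implicit Type F : nat -> V.

Definition has_fsum F (S : V) : Prop := is_flim (fun N => \sum_(n < N) F n) S.

Definition fsummable F : Prop := exists S, has_fsum F S.

Definition fsum F : V := xget 0 [set S | has_fsum F S]%classic.

Lemma has_fsumE F S : has_fsum F S -> fsum F = S.
Proof.
move=> FS; rewrite /fsum; case: xgetP => [S' _ /= FS'|/(_ S) //].
exact: is_flim_unique FS' FS.
Qed.
End FormalSum.

Section Permutations.
Local Open Scope nat_scope.

(* 'S_n permutes {0, ..., n-1}; words use the letters 1, ..., n. *)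
Definition word (n : nat) (pi : 'S_n) : seq nat :=
  [seq (pi i).+1 | i <- enum 'I_n].

Definition std (w : seq nat) : seq nat :=
  [seq count (fun b => b <= a) w | a <- w].

Definition occ (m : nat) (sigma : 'S_m) (n : nat) (pi : 'S_n) : nat :=
  count (fun i => std (take m (drop i (word pi))) == word sigma)
        (iota 0 (n.+1 - m)).

Definition letter (n : nat) (pi : 'S_n) (i : nat) : nat := nth 0 (word pi) i.-1.

Definition left_peak (n : nat) (pi : 'S_n) (i : nat) : bool :=
  [&& 2 <= i, i <= n.-1, letter pi i.-1 < letter pi i
    & letter pi i.+1 < letter pi i]
  || [&& i == 1, 2 <= n & letter pi 2 < letter pi 1].

Definition lpk (n : nat) (pi : 'S_n) : nat := count (left_peak pi) (iota 1 n).

Definition ilpk (n : nat) (pi : 'S_n) : nat := lpk (pi^-1)%g.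
End Permutations.

(* The value of the polynomial P_{sigma,n}^{ilpk} at elements s, t of a
   commutative ring. *)
Definition Pilpk (A : comNzRingType) (m : nat) (sigma : 'S_m) (n : nat)
    (s t : A) : A :=
  if n is 0%N then 1
  else \sum_(pi : 'S_n) s ^+ occ sigma pi * t ^+ ilpk pi.

Definition Pilpk0 (A : comNzRingType) (m : nat) (sigma : 'S_m) (n : nat)
    (t : A) : A := Pilpk sigma n 0 t.

(* 12...m *)
Definition incr (m : nat) : 'S_m := 1%g.

Definition usub (A : comUnitRingType) (t : A) : A := 4 * t / (1 + t) ^+ 2.

Definition zsub (A : comUnitRingType) (t x : A) : A := (1 + t) * x / (1 - t).

Definition dcoef (m j k : nat) : nat :=
  (\sum_(0 <= l < k.+1) 'C(l + j * m, l) * 'C(j * m, k - l))%N.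

Definition dcoef' (m j k : nat) : nat :=
  (\sum_(0 <= l < k.+1) 'C(l + j * m + 1, l) * 'C(j * m + 1, k - l))%N.

(* Main.v *)
(* Fix k and take the letters 0 < -1 < 1 < ... < -k < k.  Every word w over
   them has a standardization pi, in which ties between nonnegative letters are
   broken from left to right and ties between negative letters from right to
   left.  The words with standardization pi correspond to the left enriched
   fillings of pi^-1, and a transfer-matrix computation shows that their number
   is the coefficient of t^k in u^ilpk(pi) ((1+t)/(1-t))^n / (1-t).  An
   occurrence of 1 2 ... m in pi is a factor of w without forbidden step, so the
   coefficient of t^k on the left of (a) enumerates all words by length and
   number of increasing factors of length m.  Cutting a word after an initial
   increasing cluster, this series is 1 / (1 - f_k) = sum_n f_k^n, f_k being the
   coefficient of t^k in the base of the Hadamard powers.  Part (b) is s = 0, and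
   in (c) the coefficients d and d' are those of t^k in ((1+t)/(1-t))^p / (1-t),
   for p = jm and p = jm + 1, so that the sum over j is 1 - f_k. *)
From HB Require Import structures.
Require Import Defs.
From mathcomp Require Import all_boot all_order all_algebra all_fingroup.
From mathcomp Require Import boolp zify ring.
Import GRing.Theory.
Local Open Scope ring_scope.

Set Implicit Arguments.
Unset Strict Implicit.
Unset Printing Implicit Defensive.

(** * Words over a finite alphabet *)

Section Words.
Variables (K : nat) (V : nmodType).

Fixpoint words n : seq (seq nat) :=
  if n is n'.+1 then [seq a :: w | a <- iota 0 K, w <- words n'] else [:: [::]].

Lemma big_words_cons n (F : seq nat -> V) :
  \sum_(w <- words n.+1) F w = \sum_(a < K) \sum_(w <- words n) F (nat_of_ord a :: w).
Proof.
rewrite /= big_allpairs_dep.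
rewrite -(big_mkord xpredT (fun a => \sum_(w <- words n) F (a :: w))).
by rewrite /index_iota subn0.
Qed.

Lemma big_words_cat p n (F : seq nat -> V) :
  \sum_(w <- words (p + n)) F w =
  \sum_(u <- words p) \sum_(v <- words n) F (u ++ v).
Proof.
elim: p F => [|p IHp] F; first by rewrite big_seq1.
rewrite addSn !big_words_cons; apply: eq_bigr => a _.
exact: (IHp (fun w => F (nat_of_ord a :: w))).
Qed.

Lemma big_words_rcons n (F : seq nat -> V) :
  \sum_(w <- words n.+1) F w = \sum_(a < K) \sum_(u <- words n) F (rcons u a).
Proof.
rewrite -addn1 big_words_cat exchange_big big_words_cons; apply: eq_bigr => a _.
by rewrite big_seq1; apply: eq_bigr => u _; rewrite cats1.
Qed.

Lemma mem_words n w : w \in words n -> size w = n.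
Proof.
elim: n w => [|n IHn] w /=; first by rewrite inE => /eqP ->.
by case/allpairsP => -[a v] /= [_ /IHn <- ->].
Qed.

Lemma big_words_tuple n (F : seq nat -> V) :
  \sum_(w <- words n) F w = \sum_(w : n.-tuple 'I_K) F (map val w).
Proof.
elim: n F => [|n IHn] F.
  rewrite big_seq1 (big_pred1 [tuple]) // => w.
  by apply/esym/eqP; rewrite [w]tuple0.
rewrite big_words_cons.
under eq_bigr do rewrite IHn.
rewrite pair_big /= (reindex (fun w : n.+1.-tuple 'I_K => (thead w, behead_tuple w))) /=.
  by apply: eq_bigr => w _; rewrite [in RHS](tuple_eta w).
exists (fun p : 'I_K * n.-tuple 'I_K => [tuple of p.1 :: p.2]) => [w _|[a w] _] /=.
  by rewrite [RHS]tuple_eta; apply/val_inj.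
by congr (_, _); apply/val_inj.
Qed.
End Words.

(** * Increasing runs and occurrences of increasing patterns *)

Section Runs.
Variables (T : Type) (R : rel T) (m : nat).
Local Open Scope nat_scope.

Definition run_occ (w : seq T) : nat :=
  count (fun i => sorted R (take m (drop i w))) (iota 0 ((size w).+1 - m)).

(** The length of the longest sorted prefix. For empty [v] the [path] test is vacuous, so the last
    letter counts 1. *)
Fixpoint run_len (w : seq T) : nat :=
  if w is a :: v then if path R a (take 1 v) then (run_len v).+1 else 1 else 0.

Lemma run_len_size w : run_len w <= size w.
Proof. by elim: w => //= a w IHw; case: ifP. Qed.

Lemma sorted_take w j : j <= size w -> sorted R (take j w) = (j <= run_len w).
Proof.
elim: w j => [|a w IHw] [|j] //=; rewrite ltnS => jw.
case: w IHw jw => [|b w] IHw jw; first by case: j jw.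
case: j jw => [|j] jw; first by case: ifP.
have := IHw _ jw; rewrite /= take0 /= andbT => ->.
by case: (R a b).
Qed.

Lemma run_occ_cons a w : 0 < m ->
  run_occ (a :: w) = (m <= run_len (a :: w)) + run_occ w.
Proof.
move=> m0; rewrite /run_occ.
have [mw|wm] := leqP m (size w).+1; last first.
  have -> : (size (a :: w)).+1 - m = 0 by rewrite /=; lia.
  have -> : (size w).+1 - m = 0 by lia.
  have /= := run_len_size (a :: w).
  by case: leqP => //; lia.
have count_iotaS P k :
    count P (iota 0 k.+1) = P 0 + count (fun i => P i.+1) (iota 0 k).
  by rewrite /= (iotaDl 1 0) count_map.
by rewrite subSn // count_iotaS drop0 sorted_take.
Qed.

(* Within the maximal initial run, dropping letters only shortens that run. *)
Lemma run_occ_drop w j : 1 < m -> j <= run_len w ->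
  run_occ (drop j w) = ((run_len w - j).+1 - m) + run_occ (drop (run_len w) w).
Proof.
move=> m1; elim: w j => [|a w IHw] j.
  by rewrite leqn0 => /eqP ->; rewrite /run_occ /=; case: m m1 => [|[]].
case: j => [_|j].
  rewrite drop0 run_occ_cons; last lia.
  have IH0 := IHw 0 (leq0n _); rewrite drop0 in IH0.
  rewrite /=; case: ifP => _; last by rewrite /= drop0; lia.
  by rewrite /= IH0; lia.
rewrite /=; case: ifP => _ jw; first by rewrite IHw //; lia.
by have -> : j = 0; [lia|rewrite /= drop0; lia].
Qed.
End Runs.

(** Only comparisons of adjacent letters matter. This carries occurrences from a permutation to the
    words that it standardizes. *)
Lemma eq_run_occ (T T' : Type) (x : T) (x' : T') (R : rel T) (R' : rel T')
    (m : nat) (w : seq T) (w' : seq T') :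
  size w = size w' ->
  (forall i, (i.+1 < size w)%N ->
     R (nth x w i) (nth x w i.+1) = R' (nth x' w' i) (nth x' w' i.+1)) ->
  run_occ R m w = run_occ R' m w'.
Proof.
move=> sw RR; rewrite /run_occ sw; apply: eq_in_count => i; rewrite mem_iota => Hi.
have sz : size (take m (drop i w)) = size (take m (drop i w')).
  by rewrite !size_take !size_drop sw.
have lt j : (j.+1 < size (take m (drop i w)))%N ->
    (j.+1 < m)%N /\ ((i + j).+1 < size w)%N.
  by rewrite size_take size_drop; case: (ltnP m); lia.
apply/(sortedP x)/(sortedP x') => S j jlt.
  have /lt [jm jw] := eq_ind_r (fun n => j.+1 < n)%N jlt sz.
  have := S j; rewrite sz jlt !nth_take ?(ltnW jm) // !nth_drop addnS => /(_ isT).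
  by rewrite RR.
have [jm jw] := lt _ jlt.
have := S j; rewrite -sz jlt !nth_take ?(ltnW jm) // !nth_drop addnS => /(_ isT).
by rewrite RR.
Qed.

(** * Coefficients of formal power series *)

Section FpsComplements.
Variable R : comNzRingType.
Implicit Types (f g : {fps R}).

Fact fpsC_zmod_morphism : zmod_morphism (@fpsC R).
Proof. by move=> a b; apply/fpsP => -[|n] /=; rewrite ?fcoefB /= ?subr0. Qed.
HB.instance Definition _ :=
  GRing.isZmodMorphism.Build R {fps R} (@fpsC R) fpsC_zmod_morphism.

Fact fpsC_monoid_morphism : monoid_morphism (@fpsC R).
Proof. by split=> // a b; apply/fpsP => -[|n]; rewrite fcoefCM //= mulr0. Qed.
HB.instance Definition _ :=
  GRing.isMonoidMorphism.Build R {fps R} (@fpsC R) fpsC_monoid_morphism.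

Lemma fcoefXnM p f n : (fpsX R ^+ p * f) n = if (n < p)%N then 0 else f (n - p)%N.
Proof.
elim: p f n => [|p IHp] f n; first by rewrite mul1r subn0.
rewrite exprSr -mulrA IHp ltnS; case: (ltngtP n p) => [//|pn|->].
  have p1 : (1 < (n - p).+1)%N by lia.
  rewrite fcoefM (bigD1 (Ordinal p1)) //= mul1r big1 ?addr0 => [|i ni]; last first.
    by rewrite -val_eqE /= in ni; rewrite (negbTE ni) mul0r.
  by congr (f _); lia.
by rewrite subnn fcoef0M /= mul0r.
Qed.

Lemma fcoefXM f n : (fpsX R * f) n = if n is n'.+1 then f n' else 0.
Proof. by rewrite -[fpsX R]expr1 fcoefXnM; case: n => [|n] //; rewrite subn1. Qed.

Lemma fcoefXn p n : (fpsX R ^+ p) n = (n == p)%:R.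
Proof.
rewrite -[_ ^+ p]mulr1 fcoefXnM fcoef1; case: (ltngtP n p) => //= [pn|->].
  by case: eqP => //; lia.
by rewrite subnn.
Qed.

Lemma fcoefMr_lt f g p n : (forall i, (i < p)%N -> f i = 0) -> (n < p)%N -> (g * f) n = 0.
Proof.
by move=> f0 np; rewrite fcoefM big1 // => i _; rewrite f0 ?mulr0 //; lia.
Qed.

Lemma fpsCX (c : R) n : fpsC (c ^+ n) = fpsC c ^+ n.
Proof. exact: (rmorphXn (@fpsC R)). Qed.

Lemma fpsCM (a b : R) : fpsC (a * b) = fpsC a * fpsC b.
Proof. exact: (rmorphM (@fpsC R)). Qed.

Lemma fpsC_nat n : fpsC (n%:R : R) = n%:R.
Proof. exact: (rmorph_nat (@fpsC R)). Qed.

Lemma fpsC_sum (I : Type) (r : seq I) (P : pred I) (F : I -> R) :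
  fpsC (\sum_(i <- r | P i) F i) = \sum_(i <- r | P i) fpsC (F i).
Proof. exact: (rmorph_sum (@fpsC R)). Qed.
End FpsComplements.

(** * The cluster method for increasing factors of words *)

Section RunTheorem.
Variables (R : comUnitRingType) (s : R) (m : nat).
Local Notation X := (fpsX R).

Definition cluster_den : {fps R} := 1 - (fpsC s - 1) * \sum_(1 <= l < m) X ^+ l.

(* The coefficient of X^j is the total weight (s-1)^#marks of the ways to cover
   an increasing word of length j by overlapping marked occurrences of
   1 2 ... m (j = 1 needing no mark). *)
Definition cluster : {fps R} := X + (fpsC s - 1) * X ^+ m / cluster_den.

(* The weight of a maximal increasing run of length r. *)
Definition run_weight (r : nat) : R := s ^+ (r.+1 - m).

Lemma fcoef_sum_fpsX i : (\sum_(1 <= l < m) X ^+ l) i = (0 < i < m)%N%:R.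
Proof.
rewrite fcoef_sum.
elim: m => [|n IHn]; first by rewrite big_geq //; case: i.
case: n IHn => [|n] IHn; first by rewrite big_geq //; case: i {IHn} => [|[]].
rewrite big_nat_recr // IHn /= fcoefXn -natrD; congr (_%:R).
by case: eqP; lia.
Qed.

Lemma cluster_den_unit : cluster_den \is a GRing.unit.
Proof.
by rewrite fps_unitE fcoefB fcoef0M fcoef_sum_fpsX mulr0 subr0 unitr1.
Qed.

Hypothesis m_gt1 : (1 < m)%N.

Lemma fpsX_geom : (1 - X) * \sum_(1 <= l < m) X ^+ l = X - X ^+ m.
Proof.
have := telescope_sumr (fun l => X ^+ l) (ltnW m_gt1).
rewrite expr1 => tel; rewrite -[RHS]opprB -tel.
rewrite mulr_sumr -sumrN; apply: eq_bigr => l _.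
by rewrite exprS mulrBl mul1r opprB.
Qed.

Lemma cluster_denM : cluster_den * (1 - cluster) = 1 - fpsC s * X.
Proof.
rewrite /cluster mulrBr mulr1 mulrDr mulrCA divrr ?cluster_den_unit // mulr1.
rewrite -[LHS]addrA opprD addrA; apply: subr0_eq.
transitivity ((fpsC s - 1) * ((X - X ^+ m) - (1 - X) * \sum_(1 <= l < m) X ^+ l)).
  by rewrite /cluster_den; ring.
by rewrite fpsX_geom subrr mulr0.
Qed.

(** The run weight is 1 up to length [m - 1] and gains a factor [s] with each further letter, so
    multiplying by [1 - s X] leaves [cluster_den]. *)
Lemma run_weightM : Fps run_weight * (1 - cluster) = 1.
Proof.
have AsX : Fps run_weight * (1 - fpsC s * X) = cluster_den.
  apply/fpsP => i; rewrite mulrBr mulr1 [fpsC s * X]mulrC mulrCA mulrA mulrC.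
  rewrite !fcoefB fcoefCM fcoefXM -(rmorph1 (@fpsC R)) -rmorphB fcoefCM.
  rewrite fcoef_sum_fpsX fcoef1.
  case: i => [|i] /=; rewrite /run_weight /=.
    by have -> : (1 - m = 0)%N; [lia|rewrite expr0 !mulr0].
  have [im|im] /= := ltnP i.+1 m.
    by have [-> ->] : (i.+2 - m = 0)%N /\ (i.+1 - m = 0)%N; [lia|rewrite expr0; ring].
  by have -> : (i.+2 - m = (i.+1 - m).+1)%N; [lia|rewrite exprS; ring].
by apply: (mulrI cluster_den_unit); rewrite mulr1 mulrCA cluster_denM AsX.
Qed.

Lemma cluster0 : cluster 0%N = 0.
Proof.
rewrite /cluster fcoefD -mulrA (mulrCA _ (X ^+ m)) fcoefXnM /= add0r.
by case: ifP => //; lia.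
Qed.

Lemma run_weight_rec r : (0 < r)%N ->
  run_weight r = \sum_(1 <= j < r.+1) cluster j * run_weight (r - j).
Proof.
move=> r0; have /fpsP/(_ r) := run_weightM.
rewrite mulrBr mulr1 fcoefB fcoef1 mulrC fcoefM => /eqP.
case: r r0 => // r _; rewrite subr_eq0 => /eqP wr.
rewrite -[LHS]/(Fps run_weight r.+1) wr.
rewrite -(big_mkord xpredT (fun j => cluster j * run_weight (r.+1 - j))) big_ltn //.
by rewrite cluster0 mul0r add0r.
Qed.

Variables (K : nat) (le : rel nat).

(** The term [j] cuts off a cluster of [j] letters. It vanishes beyond the initial maximal run, of
    length [r]; within it, the rest of that run has weight [run_weight (r - j)], and
    [run_weight_rec] applies. *)
Lemma run_occ_rec (w : seq nat) : w != [::] ->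
  s ^+ run_occ le m w = \sum_(1 <= j < (size w).+1)
    cluster j * (sorted le (take j w))%:R * s ^+ run_occ le m (drop j w).
Proof.
move=> w0; have [r rE] : {r | r = run_len le w} by exists (run_len le w).
have r0 : (0 < r)%N by rewrite rE; case: w w0 {rE} => //= a w _; case: ifP.
have rw : (r <= size w)%N by rewrite rE run_len_size.
rewrite (big_cat_nat (n := r.+1)) //= [X in _ + X]big_nat.
rewrite [X in _ + X]big1 ?addr0; last first.
  by move=> j ?; rewrite sorted_take; [case: leqP; rewrite ?mulr0 ?mul0r //; lia|lia].
rewrite -[w in LHS]drop0 run_occ_drop // subn0 exprD -rE -/(run_weight r).
rewrite run_weight_rec // mulr_suml; apply: eq_big_nat => j jr.
rewrite sorted_take; last lia.
rewrite (run_occ_drop (j := j)) //; last lia.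
have -> : (j <= run_len le w)%N by lia.
by rewrite -rE mulr1 exprD mulrA.
Qed.

Definition word_series : {fps R} :=
  Fps (fun n => \sum_(w <- words K n) s ^+ run_occ le m w).

Definition chains n : nat := (\sum_(w <- words K n) sorted le w)%N.

(** Sum [run_occ_rec] over all words of a given length: the initial cluster and the remaining
    letters vary independently. *)
Lemma word_seriesM :
  word_series * (1 - Fps (fun j => cluster j * (chains j)%:R)) = 1.
Proof.
apply/fpsP => n; rewrite mulrBr mulr1 mulrC fcoefB fcoef1 fcoefM /=.
rewrite -(big_mkord xpredT (fun j => cluster j * (chains j)%:R *
  (\sum_(w <- words K (n - j)) s ^+ run_occ le m w))).
rewrite big_ltn // cluster0 !mul0r add0r.
case: n => [|n].
  by rewrite big_seq1 big_geq // subr0 /run_occ; case: m m_gt1.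
rewrite big_seq; under eq_bigr => w wn.
  rewrite run_occ_rec; last by rewrite -size_eq0 (mem_words wn).
  rewrite (mem_words wn); over.
rewrite -big_seq exchange_big; apply/eqP; rewrite subr_eq0; apply/eqP.
apply: eq_big_nat => j jn.
have -> : words K n.+1 = words K (j + (n.+1 - j)) by congr words; lia.
rewrite big_words_cat -mulrA /chains natr_sum mulr_suml mulr_sumr.
rewrite big_seq [RHS]big_seq; apply: eq_bigr => u uj.
rewrite !mulr_sumr; apply: eq_bigr => v _.
by rewrite take_size_cat ?drop_size_cat ?mulrA // (mem_words uj).
Qed.
End RunTheorem.

(** * Enriched words compatible with an ascent pattern *)

Section Enriched.
Local Open Scope nat_scope.

(* The letters 0 < -1 < 1 < -2 < 2 < ... are coded by 0, 1, 2, 3, 4, ...: an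
   ascent of the permutation allows equality of nonnegative (even) letters, a
   descent that of negative (odd) ones. *)
Definition enr (d : bool) (a b : nat) : bool := (a < b) || (a == b) && (odd a (+) d).

Definition compat (D : seq bool) (v : seq nat) : bool :=
  all (fun i => enr (nth true D i) (nth 0 v i) (nth 0 v i.+1)) (iota 0 (size D)).

(** A transfer matrix run from the right: [b] is the last letter and [D] lists the steps backwards,
    hence the [rev] in [sum_compat]. *)
Fixpoint ncompat (D : seq bool) (b : nat) : nat :=
  if D is d :: D' then \sum_(a < b.+1 | enr d a b) ncompat D' a else 1.

Lemma compat_rcons D d u a b : size u = size D ->
  compat (rcons D d) (rcons (rcons u a) b) = compat D (rcons u a) && enr d a b.
Proof.
move=> uD; rewrite /compat size_rcons -addn1 iotaD all_cat /= andbT add0n.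
rewrite !nth_rcons !size_rcons uD ltnSn ltnn eqxx ltnn eqxx.
congr (_ && _); apply: eq_in_all => i; rewrite mem_iota add0n => /andP[_ iD].
by rewrite !nth_rcons !size_rcons uD iD [i.+1 < _]ltnS iD ltnW.
Qed.

Lemma sum_compat K D :
  \sum_(v <- words K (size D).+1) compat D v = \sum_(b < K) ncompat (rev D) b.
Proof.
rewrite big_words_rcons; apply: eq_bigr => b _.
elim/last_ind: D b => [|D d IHD] b; first by rewrite big_seq1.
rewrite size_rcons big_words_rcons rev_rcons /=.
rewrite (big_ord_widen_cond K (enr d ^~ b) (ncompat (rev D))) ?ltn_ord // [RHS]big_mkcond.
apply: eq_bigr => a _; rewrite big_seq.
under eq_bigr => u /mem_words uD do rewrite compat_rcons //.
rewrite -big_seq; case: ifP => ab; last first.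
  (* [enr] forces [a <= b], so the bound [a < b.+1] adds no condition. *)
  have -> : enr d a b = false.
    by case: (boolP (enr d a b)) ab => //= + /negbT; rewrite /enr; lia.
  by rewrite big1 // => u _; rewrite andbF.
have/andP[-> _] := ab.
by rewrite -IHD; apply: eq_bigr => u _; rewrite andbT.
Qed.

Lemma sorted_compat n v : size v = n.+1 -> sorted (enr true) v = compat (nseq n true) v.
Proof.
move=> vn; rewrite /compat size_nseq.
apply/(sortedP 0)/allP => [S i|S i]; rewrite ?vn ?mem_iota.
  move=> /andP[_ iin]; rewrite nth_nseq iin; apply: S; rewrite vn; lia.
rewrite ltnS => iin; have := S i; rewrite mem_iota nth_nseq iin; exact.
Qed.

(** For a reversed ascent pattern: a peak is a descent preceded by an ascent. The default [true]
    makes an initial descent count, as for left peaks. *)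
Fixpoint npeaks (D : seq bool) : nat :=
  if D is d :: D' then (~~ d && head true D') + npeaks D' else 0.
End Enriched.

(** * Generating series of compatible words *)

Definition rho (A : comUnitRingType) : {fps A} := (1 + fpsX A) / (1 - fpsX A).

Section EnrichedSeries.
Variable A : comUnitRingType.
Local Notation t := (fpsX A).

Lemma oneDX_unit : (1 + t) \is a GRing.unit.
Proof. by rewrite fps_unitE fcoefD /= addr0 unitr1. Qed.

Lemma oneBX_unit : (1 - t) \is a GRing.unit.
Proof. by rewrite fps_unitE fcoefB /= subr0 unitr1. Qed.

(** The exponent is the absolute value of the last letter: [j] is coded by [2j] and [-j] by
    [2j - 1], hence the shift and the zero constant term in [odd_series]. *)
Definition even_series D : {fps A} := Fps (fun j => (ncompat D j.*2)%:R).
Definition odd_series D : {fps A} :=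
  Fps (fun j => if j is j'.+1 then (ncompat D j'.*2.+1)%:R else 0).
Definition odd_sums D : {fps A} :=
  Fps (fun j => (\sum_(b < j.*2.+1) ncompat D b)%:R).
Definition even_sums D : {fps A} :=
  Fps (fun j => (\sum_(b < j.*2) ncompat D b)%:R).

Lemma odd_sumsM D : (1 - t) * odd_sums D = even_series D + odd_series D.
Proof.
apply/fpsP => -[|j]; rewrite mulrBl mul1r fcoefB fcoefXM fcoefD /=.
  by rewrite big_ord_recl big_ord0 addn0 subr0 addr0.
by rewrite doubleS !big_ord_recr /= !natrD; ring.
Qed.

Lemma even_sumsM D : (1 - t) * even_sums D = t * even_series D + odd_series D.
Proof.
apply/fpsP => -[|j]; rewrite mulrBl mul1r fcoefB fcoefXM fcoefD fcoefXM /=.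
  by rewrite big_ord0 subr0 addr0.
by rewrite doubleS !big_ord_recr /= !natrD; ring.
Qed.

(** The admissible predecessors form an initial segment, which contains [b] itself exactly when a
    tie is allowed. *)
Lemma ncompat_cons d D b :
  ncompat (d :: D) b = (\sum_(a < b + (odd b (+) d)) ncompat D a)%N.
Proof.
rewrite /= big_mkcond big_ord_recr /= /enr ltnn eqxx /=.
have -> : (\sum_(i < b) (if (i < b)%N || (i == b :> nat) && (odd i (+) d)
                         then ncompat D i else 0)
           = \sum_(i < b) ncompat D i)%N.
  by apply: eq_bigr => i _; rewrite ltn_ord.
by case: (odd b (+) d); rewrite ?addn1 ?addn0 // big_ord_recr.
Qed.

Lemma even_series_cons d D :
  even_series (d :: D) = if d then odd_sums D else even_sums D.
Proof.
apply/fpsP => j; rewrite /even_series /=.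
rewrite -/(ncompat (d :: D) _) ncompat_cons odd_double.
by case: d; rewrite /= ?addn1 ?addn0.
Qed.

Lemma odd_series_cons d D :
  odd_series (d :: D) = if d then t * odd_sums D else even_sums D.
Proof.
apply/fpsP => -[|j]; first by case: d; rewrite ?fcoefXM //= big_ord0.
rewrite -[LHS]/(ncompat (d :: D) j.*2.+1)%:R ncompat_cons /= odd_double.
by case: d; rewrite ?fcoefXM /= ?addn0 // addn1 doubleS.
Qed.

(** An ascent into [-j] has the same possible predecessors as one into [j - 1]; a descent into [-j]
    has the same ones as a descent into [j]. *)
Lemma odd_even_series D :
  odd_series D = (if head true D then t else 1) * even_series D.
Proof.
case: D => [|d D]; last first.
  by rewrite odd_series_cons even_series_cons; case: d; rewrite ?mul1r.
by apply/fpsP => -[|j]; rewrite fcoefXM.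
Qed.

(** With this prefactor every step multiplies by [rho]. A descent that is initial or follows an
    ascent brings the extra factor [usub t], because [2 * 2t = (1 + t)^2 u]. *)
Lemma even_seriesE D :
  (if head true D then 1 + t else 2) * even_series D
  = rho A ^+ (size D).+1 * usub t ^+ npeaks D.
Proof.
have [dU bU] := (oneDX_unit, oneBX_unit).
elim: D => [|d D IHD].
  rewrite /= expr0 mulr1 expr1 /rho; congr (_ * _); apply: (mulrI bU).
  rewrite divrr //; apply/fpsP => j; rewrite mulrBl mul1r fcoefB fcoefXM fcoef1.
  by case: j => [|j]; rewrite /= ?subr0 ?subrr.
rewrite even_series_cons [size _]/= exprS -mulrA.
apply: (mulrI bU); rewrite mulrCA.
have -> : (1 - t) * (rho A * (rho A ^+ (size D).+1 * usub t ^+ npeaks (d :: D)))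
  = (1 + t) * (rho A ^+ (size D).+1 * usub t ^+ npeaks D)
    * usub t ^+ (~~ d && head true D).
  rewrite [npeaks _]/= exprD /rho [(1 + t) / _]mulrC !mulrA divrr //; ring.
rewrite -IHD; case: d => /=.
  rewrite odd_sumsM odd_even_series expr0 mulr1; case: head; ring.
rewrite even_sumsM odd_even_series; case: head; last by rewrite expr0; ring.
rewrite expr1 /usub !mulrA.
apply: (mulIr (unitrX 2 dU)); rewrite mulrVK ?unitrX //; ring.
Qed.

(** Summing over all last letters reproduces the prefactor of [even_seriesE], so the dependence on
    the last step disappears. *)
Lemma odd_sumsE D :
  odd_sums D = (1 - t)^-1 * (rho A ^+ (size D).+1 * usub t ^+ npeaks D).
Proof.
rewrite -even_seriesE; apply: (mulrI oneBX_unit).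
rewrite mulrA divrr ?oneBX_unit // mul1r odd_sumsM odd_even_series.
by case: head; ring.
Qed.
End EnrichedSeries.

(** * Occurrences and left peaks read off the word of a permutation *)

Section PermWords.
Local Open Scope nat_scope.

(** A non-ascent at [i] would make the rank at [i.+1] at most that at [i]. Conversely, the head of
    an increasing word has rank 1 and raises all later ranks by one. *)
Lemma std_iota v : (std v == iota 1 (size v)) = sorted ltn v.
Proof.
apply/eqP/idP => [stdv|].
  apply/(sortedP 0) => i iv; rewrite /= ltnNge; apply/negP => vi.
  have cnt j : j < size v -> count (fun b => b <= nth 0 v j) v = j.+1.
    move=> jv; rewrite -(nth_map 0 0 (fun a => count (fun b => b <= a) v)) //.
    by rewrite -/(std v) stdv nth_iota.
  have := @sub_count _ (fun b => b <= nth 0 v i.+1) (fun b => b <= nth 0 v i).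
  by move=> /(_ (fun b bi => leq_trans bi vi) v); rewrite !cnt ?ltnn // ltnW.
elim: v => //= a v IHv av; rewrite /std /= leqnn.
have a_lt := order_path_min ltn_trans av.
congr (_ :: _).
  rewrite (eq_in_count (a2 := pred0)) ?count_pred0 // => b bv /=.
  by have /= := allP a_lt b bv; case: leqP.
rewrite (iotaDl 1 1) -IHv ?(path_sorted av) // /std -map_comp.
apply/eq_in_map => b bv /=.
by have /= /ltnW -> := allP a_lt b bv.
Qed.

Variable n : nat.
Implicit Type pi tau : 'S_n.

Lemma size_word pi : size (word pi) = n.
Proof. by rewrite size_map size_enum_ord. Qed.

Lemma nth_map_enum_ord (f : 'I_n -> nat) (i : 'I_n) :
  nth 0 [seq f j | j <- enum 'I_n] i = f i.
Proof. by rewrite (nth_map i) ?size_enum_ord // nth_ord_enum. Qed.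

Lemma nth_word pi (i : 'I_n) : nth 0 (word pi) i = (pi i).+1.
Proof. exact: nth_map_enum_ord. Qed.

Lemma word_incr m : word (incr m) = iota 1 m.
Proof.
rewrite (iotaDl 1 0) -val_enum_ord -map_comp.
by apply: eq_map => i; rewrite perm1.
Qed.

Lemma occ_incr m pi : occ (incr m) pi = run_occ ltn m (word pi).
Proof.
rewrite /occ /run_occ size_word word_incr; apply: eq_in_count => i.
rewrite mem_iota => iin; rewrite -std_iota size_takel // size_drop size_word; lia.
Qed.

Definition ascents (q : seq nat) : seq bool :=
  mkseq (fun i => nth 0 q i < nth 0 q i.+1) (size q).-1.

(** The prepended [true] acts as an ascent before the first letter. *)
Lemma npeaks_rev D :
  npeaks (rev D) =
  count (fun i => ~~ nth true D i && nth true (true :: D) i) (iota 0 (size D)).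
Proof.
elim/last_ind: D => [//|D d IHD].
rewrite rev_rcons size_rcons -addn1 iotaD count_cat /= addn0 add0n IHD addnC.
congr (_ + _).
  apply: eq_in_count => i; rewrite mem_iota add0n => /andP[_ iD].
  by rewrite -rcons_cons !nth_rcons iD /= ltnW.
rewrite -rcons_cons !nth_rcons ltnn eqxx /= ltnSn.
congr (nat_of_bool (_ && _)); elim/last_ind: D {IHD} => [|D e _] //.
by rewrite rev_rcons size_rcons /= nth_rcons ltnn eqxx.
Qed.

Lemma lpk_npeaks tau : lpk tau = npeaks (rev (ascents (word tau))).
Proof.
rewrite npeaks_rev size_mkseq size_word /lpk.
have [n0|n0] := posnP n.
  have -> : iota 1 n = [::] by rewrite n0.
  by have -> : iota 0 n.-1 = [::] by rewrite n0.
have -> : iota 1 n = iota 1 n.-1 ++ [:: n].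
  by have := iotaD 1 n.-1 1; rewrite addn1 add1n prednK.
(* Position [n] is never a left peak. *)
have -> : count (left_peak tau) (iota 1 n.-1 ++ [:: n])
          = count (left_peak tau) (iota 1 n.-1).
  by rewrite count_cat /= /left_peak; lia.
rewrite (iotaDl 1 0) count_map.
apply: eq_in_count => i; rewrite mem_iota add0n /= add1n => iin.
rewrite /ascents size_word nth_mkseq // /left_peak /letter /=.
have neq j : j.+1 < n -> (nth 0 (word tau) j.+1 < nth 0 (word tau) j)
    = ~~ (nth 0 (word tau) j < nth 0 (word tau) j.+1).
  move=> jn; rewrite (nth_word tau (Ordinal jn)) (nth_word tau (Ordinal (ltnW jn))).
  rewrite -leqNgt ltn_neqAle eqSS.
  by case: eqP => //= e; have /(congr1 val) /= := perm_inj (val_inj e); lia.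
case: i iin => [|i] iin /=; first by rewrite neq; lia.
rewrite nth_mkseq; last lia.
rewrite neq; lia.
Qed.
End PermWords.

(** * Standardization of enriched words *)

Section Standardization.
Variables (n K : nat).
Implicit Types (w : n.-tuple 'I_K) (pi : 'S_n).
Local Open Scope nat_scope.

(* Ranks the positions of w by their letters; ties are broken from left to
   right for even letters and from right to left for odd ones. *)
Definition key w (i : 'I_n) : nat :=
  tnth w i * n + (if odd (tnth w i) then n.-1 - i else i).

(** Since the tie-breaker is below [n], keys compare lexicographically. On equal letters, positions
    compare directly or in reverse according to parity. *)
Lemma key_enr w i j : i != j -> (key w i < key w j) = enr (i < j) (tnth w i) (tnth w j).
Proof.
rewrite -val_eqE /key /enr /= => ij.
have lex a b x y : x < n -> y < n ->
  (a * n + x < b * n + y) = (a < b) || (a == b) && (x < y).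
  move=> xn yn; case: (ltngtP a b) => /= [ab|ba|->]; last by rewrite ltn_add2l.
    by apply/idP; nia.
  by apply/negbTE; rewrite -leqNgt; nia.
have := (ltn_ord i, ltn_ord j) => -[iltn jltn].
rewrite lex; [|by case: ifP; lia|by case: ifP; lia].
case: eqP => //= ->.
by congr (_ || _); case: odd; lia.
Qed.

Lemma key_inj w : injective (key w).
Proof.
move=> i j kij; apply/eqP/negPn/negP => ij.
have := key_enr w ij; have := key_enr w (j := i) (i := j).
rewrite eq_sym => /(_ ij); rewrite kij ltnn /enr => /esym + /esym.
move: ij; rewrite -val_eqE /=; lia.
Qed.

Definition sorts w pi : bool :=
  [forall i, forall j, (pi i < pi j) == (key w i < key w j)].

Lemma nth_letters w (i : 'I_n) : nth 0 (map val w) i = tnth w i.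
Proof. by rewrite (nth_map (tnth w i)) ?size_tuple // -tnth_nth. Qed.

(** Read along [pi^-1], compatibility says that consecutive keys increase. By transitivity all keys
    are then in the order prescribed by [pi]. *)
Lemma sorts_compat w pi :
  compat (ascents (word pi^-1%g)) (map val [tuple tnth w (pi^-1%g i) | i < n])
  = sorts w pi.
Proof.
set tau := (pi^-1)%g.
have nthv (i : 'I_n) : nth 0 (map val [tuple tnth w (tau i) | i < n]) i = tnth w (tau i).
  by rewrite nth_letters tnth_mktuple.
have step i (i1 : i.+1 < n) :
    enr (nth true (ascents (word tau)) i)
     (nth 0 (map val [tuple tnth w (tau i) | i < n]) i)
     (nth 0 (map val [tuple tnth w (tau i) | i < n]) i.+1)
    = (key w (tau (Ordinal (ltnW i1))) < key w (tau (Ordinal i1))).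
  rewrite key_enr; last by rewrite (inj_eq perm_inj) -val_eqE /=; lia.
  rewrite (nthv (Ordinal i1)) (nthv (Ordinal (ltnW i1))).
  rewrite nth_mkseq ?size_word; last lia.
  by rewrite (nth_word tau (Ordinal i1)) (nth_word tau (Ordinal (ltnW i1))).
rewrite /compat size_mkseq size_word.
apply/allP/forallP => [S i|S i].
  have srt : sorted ltn [seq key w (tau i) | i <- enum 'I_n].
    apply/(sortedP 0) => j; rewrite size_map size_enum_ord => jn.
    rewrite (nth_map_enum_ord _ (Ordinal jn)) (nth_map_enum_ord _ (Ordinal (ltnW jn))).
    rewrite /= -step.
    by apply: S; rewrite mem_iota; lia.
  have mono (j k : 'I_n) : j < k -> key w (tau j) < key w (tau k).
    move=> jk; have := sorted_ltn_nth ltn_trans 0 srt.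
    move=> /(_ j k); rewrite !inE size_map size_enum_ord !ltn_ord => /(_ isT isT jk).
    by rewrite !nth_map_enum_ord.
  apply/forallP => j; apply/eqP.
  have piK k : tau (pi k) = k by rewrite permK.
  case: (ltngtP (pi i) (pi j)) => [/mono|/mono|/val_inj/perm_inj ->];
    rewrite ?piK ?ltnn //.
  by move=> h; apply/esym/negbTE; rewrite -leqNgt ltnW.
rewrite mem_iota add0n => iin; have i1 : i.+1 < n by lia.
rewrite (step i i1).
have /forallP/(_ (tau (Ordinal i1)))/eqP := S (tau (Ordinal (ltnW i1))).
by rewrite !permKV /= ltnSn => <-.
Qed.

Lemma card_ord_lt (i : 'I_n) : #|[set k : 'I_n | k < i]| = i.
Proof.
rewrite -sum1_card; under eq_bigl do rewrite inE.
by rewrite -(big_ord_widen n (fun=> 1)) ?sum1_card ?card_ord // ltnW.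
Qed.

(** Send each position to the number of smaller keys; this is a permutation because the keys are
    distinct. *)
Lemma sorts_unique w : exists pi0 : 'S_n, forall pi, sorts w pi = (pi == pi0).
Proof.
pose rank i : nat := #|[set j | key w j < key w i]|.
have rank_mono i j : (rank i < rank j) = (key w i < key w j).
  have sub k l : key w k <= key w l -> rank k <= rank l.
    move=> kl; apply: subset_leq_card; apply/subsetP => h; rewrite !inE => hk.
    exact: leq_trans hk kl.
  case: (ltnP (key w i) (key w j)) => [ij|/sub]; last by rewrite ltnNge => ->.
  apply: proper_card; apply/properP; split.
    apply/subsetP => h; rewrite !inE => hi; exact: ltn_trans hi ij.
  by exists i; rewrite !inE ?ltnn.
have rank_lt i : rank i < n.
  rewrite -[X in _ < X]card_ord -cardsT; apply: proper_card; apply/properP.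
  by split; [apply: subsetT|exists i; rewrite !inE ?ltnn].
have rank_inj : injective (fun i => Ordinal (rank_lt i)).
  move=> i j /(congr1 val) /= rij; apply: (@key_inj w); apply/eqP.
  have := rank_mono i j; have := rank_mono j i; rewrite rij ltnn.
  by rewrite eqn_leq [key w i <= _]leqNgt [key w j <= _]leqNgt => <- <-.
exists (perm rank_inj) => pi; apply/forallP/eqP => [S|-> i]; last first.
  by apply/forallP => j; rewrite !permE /= rank_mono.
(* Uniqueness: [pi i] is the number of positions [j] with [pi j < pi i], which [sorts] expresses by
   keys. *)
apply/permP => i; apply/val_inj; rewrite permE /= /rank -[LHS]card_ord_lt.
rewrite -(on_card_preimset (f := pi)); last first.
  by exists (pi^-1)%g => k _; [apply: permK|apply: permKV].
apply: eq_card => j; rewrite !inE.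
by have /forallP/(_ i)/eqP := S j.
Qed.

Lemma sorts_occ m w pi : sorts w pi ->
  occ (incr m) pi = run_occ (enr true) m (map val w).
Proof.
move=> /forallP S; rewrite occ_incr.
apply: (eq_run_occ (x := 0) (x' := 0)) => [|i];
  rewrite size_word ?size_map ?size_tuple // => i1.
rewrite (nth_word pi (Ordinal i1)) (nth_word pi (Ordinal (ltnW i1))) /= ltnS.
have /forallP/(_ (Ordinal i1))/eqP -> := S (Ordinal (ltnW i1)).
rewrite key_enr; last by rewrite -val_eqE /=; lia.
by rewrite /= ltnSn (nth_letters w (Ordinal i1)) (nth_letters w (Ordinal (ltnW i1))).
Qed.
End Standardization.

(** Double counting of the pairs formed by a word and its standardization; by [sorts_occ] both have
    the same occurrences. *)
Lemma sum_occ_compat (R : comNzRingType) (s : R) (m n K : nat) :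
  \sum_(pi : 'S_n) s ^+ occ (incr m) pi *
     (\sum_(v <- words K n) compat (ascents (word pi^-1%g)) v)%N%:R
  = \sum_(w <- words K n) s ^+ run_occ (enr true) m w.
Proof.
rewrite [RHS]big_words_tuple.
transitivity (\sum_(pi : 'S_n) \sum_(w : n.-tuple 'I_K)
    (sorts w pi)%:R * s ^+ run_occ (enr true) m (map val w)).
  apply: eq_bigr => pi _.
  rewrite big_words_tuple natr_sum mulr_sumr.
  (* Rearranging the letters along [pi^-1] is a bijection on words. *)
  rewrite (reindex (fun w : n.-tuple 'I_K => [tuple tnth w (pi^-1%g i) | i < n])) /=.
    apply: eq_bigr => w _; rewrite sorts_compat.
    have [S|] := boolP (sorts w pi); last by rewrite mulr0 mul0r.
    by rewrite mul1r mulr1 (sorts_occ m S).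
  exists (fun v : n.-tuple 'I_K => [tuple tnth v (pi i) | i < n]) => w _;
    by apply/eq_from_tnth => i; rewrite !tnth_mktuple ?permK ?permKV.
rewrite exchange_big; apply: eq_bigr => w _.
have [pi0 S] := sorts_unique w.
rewrite (bigD1 pi0) //= S eqxx mul1r big1 ?addr0 // => pi /negbTE ne.
by rewrite S ne mul0r.
Qed.

(** * Coefficients in [t] as numbers of words *)

Section Geometric.
Variable A : comUnitRingType.
Local Notation t := (fpsX A).

Lemma inv1BX : (1 - t)^-1 = Fps (fun=> 1).
Proof.
apply: (mulrI (oneBX_unit A)); rewrite divrr ?oneBX_unit //.
by apply/fpsP => -[|k]; rewrite mulrBl mul1r fcoefB fcoefXM fcoef1 /= ?subr0 ?subrr.
Qed.

Lemma fcoef_div1BX (f : {fps A}) k : ((1 - t)^-1 * f) k = \sum_(i < k.+1) f i.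
Proof. by rewrite mulrC fcoefM inv1BX; apply: eq_bigr => i _; rewrite mulr1. Qed.

Lemma fcoef_1DXn p k : ((1 + t) ^+ p) k = 'C(p, k)%:R.
Proof.
elim: p k => [|p IHp] k; first by rewrite fcoef1 bin0n.
rewrite exprS mulrDl mul1r fcoefD fcoefXM IHp.
by case: k => [|k]; rewrite ?addr0 ?bin0 // IHp binS natrD.
Qed.

Lemma fcoef_inv1BXn p k : ((1 - t)^-1 ^+ p.+1) k = 'C(k + p, k)%:R.
Proof.
elim: p k => [|p IHp] k; first by rewrite expr1 inv1BX addn0 binn.
suff -> : (1 - t)^-1 ^+ p.+2 = Fps (fun k => 'C(k + p.+1, k)%:R) by [].
rewrite exprS; apply: (mulrI (oneBX_unit A)).
rewrite mulrA divrr ?oneBX_unit // mul1r; apply/fpsP => {}k.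
rewrite IHp mulrBl mul1r fcoefB fcoefXM /=; case: k => [|k]; rewrite ?bin0 ?subr0 //.
by rewrite [(k.+1 + p.+1)%N]addSn binS natrD addrK addSnnS.
Qed.

(** The Cauchy product of [(1 - t)^-(p+1)] and [(1 + t)^p]; [p = j * m] and [p = j * m + 1] give
    [dcoef] and [dcoef']. *)
Lemma fcoef_rhoX p k :
  ((1 - t)^-1 * rho A ^+ p) k
  = (\sum_(0 <= l < k.+1) 'C(l + p, l) * 'C(p, k - l))%N%:R.
Proof.
rewrite /rho expr_div_n mulrCA -exprVn -exprS mulrC fcoefM big_mkord natr_sum.
by apply: eq_bigr => l _; rewrite fcoef_inv1BXn fcoef_1DXn natrM.
Qed.

Lemma hadamard_expE (f : {fps A}) n k : hadamard_exp f n k = f k ^+ n.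
Proof.
elim: n => [|n IHn]; first by rewrite /hadamard_exp /= inv1BX.
by rewrite exprS -IHn.
Qed.

(** For [n > 0], increasing words are those compatible with the pattern of ascents only, which has
    no peak. The alphabet has [2k + 1] letters, those of absolute value at most [k]. *)
Lemma fcoef_chains k n :
  ((1 - t)^-1 * rho A ^+ n) k = (chains k.*2.+1 (enr true) n)%:R.
Proof.
case: n => [|n]; first by rewrite mulr1 inv1BX /chains big_seq1.
have pk0 : npeaks (nseq n true) = 0%N by elim: n => //= n ->.
have := odd_sumsE A (nseq n true); rewrite size_nseq pk0 mulr1 => <- /=.
congr (_%:R); rewrite -(rev_nseq n true) -sum_compat size_nseq /chains.
by rewrite big_seq [RHS]big_seq; apply: eq_bigr => v /mem_words/sorted_compat ->.
Qed.

Lemma fcoef_ilpk n (pi : 'S_n) k : (0 < n)%N ->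
  ((1 - t)^-1 * (rho A ^+ n * usub t ^+ ilpk pi)) k
  = (\sum_(v <- words k.*2.+1 n) compat (ascents (word pi^-1%g)) v)%N%:R.
Proof.
move=> n0; set D := ascents (word pi^-1%g).
have sD : (size D).+1 = n by rewrite size_mkseq size_word prednK.
have := odd_sumsE A (rev D); rewrite size_rev sD => peaksD.
by rewrite /ilpk lpk_npeaks -/D -peaksD /= -sum_compat sD.
Qed.
End Geometric.

(** * Substitution of [z] for the variable *)

Section Eval.
Variable R : comUnitRingType.
Local Notation t := (fpsX {fps R}).
Local Notation x := (fpsC (fpsX R)).
Local Notation z := (zsub t x).

(* The coefficient of t^k x^j in z^j is that of t^k in rho^j, so this is
   substitution of z for the variable. *)
Definition eval_z (f : {fps R}) : {fps {fps R}} :=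
  Fps (fun k => Fps (fun j => f j * (rho R ^+ j) k)).

Fact eval_z_zmod_morphism : zmod_morphism eval_z.
Proof.
by move=> f g; apply/fpsP => k; apply/fpsP => j; rewrite !fcoefB /= mulrBl.
Qed.
HB.instance Definition _ :=
  GRing.isZmodMorphism.Build {fps R} {fps {fps R}} eval_z eval_z_zmod_morphism.

Lemma eval_zC c : eval_z (fpsC c) = fpsC (fpsC c).
Proof.
apply/fpsP => k; apply/fpsP => -[|j] /=; last by rewrite mul0r; case: k.
by case: k => [|k] /=; rewrite ?mulr1 ?mulr0.
Qed.

Fact eval_z_monoid_morphism : monoid_morphism eval_z.
Proof.
split; first exact: eval_zC.
move=> f g; apply/fpsP => k; apply/fpsP => j.
rewrite [in RHS]fcoefM fcoef_sum.
rewrite [LHS]/= mulr_suml; under [RHS]eq_bigr do rewrite fcoefM.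
rewrite [RHS]exchange_big; apply: eq_bigr => l _ /=.
have -> : rho R ^+ j = rho R ^+ l * rho R ^+ (j - l).
  by rewrite -exprD subnKC // -ltnS.
by rewrite fcoefM mulr_sumr; apply: eq_bigr => i _; ring.
Qed.
HB.instance Definition _ :=
  GRing.isMonoidMorphism.Build {fps R} {fps {fps R}} eval_z eval_z_monoid_morphism.

Lemma eval_zX : eval_z (fpsX R) = z.
Proof.
have bU := oneBX_unit {fps R}.
apply: (mulIr bU); rewrite /zsub divrK //; apply/fpsP => k; apply/fpsP => j.
have : rho R * (1 - fpsX R) = 1 + fpsX R.
  by rewrite /rho divrK ?oneBX_unit.
(* Once [1 - t] is cleared, [rho] enters only through [rho R * (1 - t) = 1 + t]. *)
rewrite /eval_z; move: (rho R) => r /fpsP/(_ k).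
rewrite [r * _]mulrC mulrBl mul1r fcoefB fcoefXM fcoefD fcoef1 => rk.
rewrite mulrC mulrBl mul1r !fcoefB fcoefXM mulrDl mul1r !fcoefD fcoefXM /=.
case: k rk => [|[|k]] /=; case: (j =P 1%N) => [->|j1] rk;
  rewrite ?fcoef0 ?expr1 ?mul0r ?mul1r ?subr0 ?addr0 ?add0r //;
  by move: rk; rewrite ?subr0 ?addr0 ?add0r; apply.
Qed.

Lemma eval_zXn n : eval_z (fpsX R ^+ n) = z ^+ n.
Proof. by rewrite -eval_zX; apply: (rmorphXn eval_z). Qed.

Lemma fcoef_eval_z (g : {fps R}) k :
  ((1 - t)^-1 * eval_z g) k
  = Fps (fun j => g j * (chains k.*2.+1 (enr true) j)%:R).
Proof.
rewrite fcoef_div1BX; apply/fpsP => j; rewrite fcoef_sum /= -mulr_sumr.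
by rewrite -fcoef_chains fcoef_div1BX.
Qed.
End Eval.

(** * Both sides of (a) as the series of all words *)

Section MainIdentity.
Variables (R : comUnitRingType) (s : R) (m : nat).
Hypothesis m_gt1 : (1 < m)%N.
Local Notation t := (fpsX {fps R}).
Local Notation x := (fpsC (fpsX R)).
Local Notation z := (zsub t x).
Local Notation S := (fpsC (fpsC s)).

Definition word_series_t : {fps {fps R}} :=
  Fps (fun k => word_series s m k.*2.+1 (enr true)).

Definition cluster_series : {fps {fps R}} := (1 - t)^-1 * eval_z (cluster s m).

Lemma zsub_rho : z = x * rho {fps R}.
Proof. by rewrite /zsub /rho [_ * x]mulrC mulrA. Qed.

(** For [n > 0], [fcoef_ilpk] replaces each permutation by the words compatible with its inverse,
    and [sum_occ_compat] regroups them. *)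
Lemma fcoef_Pilpk n k :
  ((1 - t)^-1 * (Pilpk (incr m) n S (usub t) * z ^+ n)) k
  = fpsC (word_series s m k.*2.+1 (enr true) n) * fpsX R ^+ n.
Proof.
case: n => [|n].
  rewrite !mulr1 /= inv1BX big_seq1 /run_occ.
  by have -> : (1 - m = 0)%N; [lia|rewrite expr0 rmorph1].
rewrite /Pilpk zsub_rho exprMn -fpsCX mulr_suml mulr_sumr fcoef_sum.
rewrite -[word_series _ _ _ _ _]/
  (\sum_(w <- words k.*2.+1 n.+1) s ^+ run_occ (enr true) m w).
rewrite -sum_occ_compat fpsC_sum mulr_suml; apply: eq_bigr => pi _.
rewrite -!fpsCX.
have -> : forall a b c d e : {fps {fps R}},
    e * (a * b * (c * d)) = a * (c * (e * (d * b))).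
  by move=> *; ring.
by rewrite !fcoefCM fcoef_ilpk // fpsCM fpsC_nat; ring.
Qed.

(** Only the term [n = j] contributes to [x^j], so the partial sums are constant from [j + 1] on. *)
Lemma Pilpk_sum k j : eventually_const
  (fun N => (\sum_(n < N) Pilpk (incr m) n S (usub t) * z ^+ n) k j)
  (((1 - t) * word_series_t) k j).
Proof.
exists j.+1 => N jN.
pose M n := (1 - t)^-1 * (Pilpk (incr m) n S (usub t) * z ^+ n).
have -> : \sum_(n < N) Pilpk (incr m) n S (usub t) * z ^+ n = (1 - t) * \sum_(n < N) M n.
  by rewrite mulr_sumr; apply: eq_bigr => n _; rewrite mulVKr ?oneBX_unit.
have Mij n i : M n i j = word_series s m i.*2.+1 (enr true) n * (j == n)%:R.
  by rewrite /M fcoef_Pilpk fcoefCM fcoefXn.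
have ME i : (\sum_(n < N) M n) i j = word_series_t i j.
  rewrite !fcoef_sum; under eq_bigr do rewrite Mij.
  rewrite (bigD1 (Ordinal jN)) //= eqxx mulr1 [X in _ + X]big1 ?addr0 // => n.
  by rewrite -val_eqE eq_sym => /negbTE /= ->; rewrite mulr0.
rewrite !mulrBl !mul1r !fcoefB ME !fcoefXM.
by case: k => [|k] //; rewrite ME.
Qed.

Lemma cluster_series0 k : cluster_series k 0%N = 0.
Proof. by rewrite fcoef_eval_z -[LHS]/(cluster s m 0%N * _) cluster0 // mul0r. Qed.

Lemma word_series_tM k : word_series_t k * (1 - cluster_series k) = 1.
Proof. by rewrite fcoef_eval_z; apply: word_seriesM. Qed.

(** Hadamard powers act on each coefficient of [t] separately, giving a geometric series. Its
    remainder has order at least [N] in [x] because [cluster_series k] has no constant term. *)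
Lemma hadamard_sum k j : eventually_const
  (fun N => (\sum_(n < N) hadamard_exp cluster_series n) k j) (word_series_t k j).
Proof.
exists j.+1 => N jN; rewrite fcoef_sum.
under eq_bigr do rewrite hadamard_expE.
have -> : \sum_(n < N) cluster_series k ^+ n =
    word_series_t k - word_series_t k * cluster_series k ^+ N.
  rewrite -[LHS]mul1r -(word_series_tM k) -mulrA -[1 - _]opprB mulNr -subrX1; ring.
rewrite fcoefB (fcoefMr_lt _ (p := N)) ?subr0 // => i iN.
exact: fcoefX_lt (cluster_series0 k) iN.
Qed.

(** [eval_z] is a ring morphism, so it carries the closed form of [cluster] to an expression in
    [z]. *)
Lemma cluster_seriesP :
  z / (1 - t) + (S - 1) * z ^+ m / ((1 - t) * (1 - (S - 1) * \sum_(1 <= l < m) z ^+ l))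
  = cluster_series.
Proof.
have dU := cluster_den_unit s m.
have dE : eval_z (cluster_den s m) = 1 - (S - 1) * \sum_(1 <= l < m) z ^+ l.
  rewrite rmorphB rmorph1 rmorphM rmorphB rmorph1 /= eval_zC rmorph_sum.
  by congr (_ - _ * _); apply: eq_bigr => l _; apply: eval_zXn.
rewrite /cluster_series /cluster rmorphD rmorphM rmorphV // rmorphM rmorphB rmorph1 /=.
rewrite eval_zXn eval_zX eval_zC dE invrM ?oneBX_unit //; last first.
  by rewrite -dE; apply: rmorph_unit.
by ring.
Qed.
End MainIdentity.

(** * The case [s = 0] and the reciprocal series of (c) *)

Section AvoidingCase.
Variables (R : comUnitRingType) (m : nat).
Hypothesis m_gt1 : (1 < m)%N.
Local Notation X := (fpsX R).
Local Notation t := (fpsX {fps R}).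
Local Notation x := (fpsC (fpsX R)).
Local Notation z := (zsub t x).

Lemma oneBXm_unit : 1 - X ^+ m \is a GRing.unit.
Proof.
rewrite fps_unitE fcoefB fcoefXn.
by case: m m_gt1 => // p _; rewrite subr0 unitr1.
Qed.

(** At [s = 0] the numerator [1 - s X] of [1 - cluster] is 1, and [cluster_den] is
    [(1 - X^m) / (1 - X)]. *)
Lemma cluster_s0 : 1 - cluster 0 m = (1 - X) / (1 - X ^+ m).
Proof.
apply: (mulrI oneBXm_unit); rewrite mulrC [RHS]mulrC divrK ?oneBXm_unit //.
have -> : 1 - X ^+ m = (1 - X) * cluster_den 0 m.
  have := fpsX_geom R m_gt1; rewrite /cluster_den raddf0 => geom.
  by rewrite mulrBr mulrCA geom; ring.
by rewrite mulrC -mulrA cluster_denM // raddf0 mul0r subr0 mulr1.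
Qed.

Lemma cluster_series_s0 :
  z * (1 - z ^+ m.-1) / ((1 - t) * (1 - z ^+ m)) = cluster_series 0 m.
Proof.
have zU : 1 - z ^+ m \is a GRing.unit.
  have <- : eval_z (1 - X ^+ m) = 1 - z ^+ m.
    by rewrite (rmorphB (@eval_z R)) rmorph1; congr (1 - _); apply: eval_zXn.
  exact: rmorph_unit oneBXm_unit.
have evM : (1 - z ^+ m) * eval_z (cluster 0 m) = z - z ^+ m.
  rewrite -eval_zXn -eval_zX -(rmorph1 (@eval_z R)).
  rewrite -!(rmorphB (@eval_z R)) -(rmorphM (@eval_z R)).
  congr eval_z; rewrite -[cluster 0 m](subKr 1) cluster_s0 mulrBr mulr1.
  by rewrite [_ * (_ / _)]mulrC divrK ?oneBXm_unit //; ring.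
rewrite /cluster_series invrM ?oneBX_unit //.
have -> : z * (1 - z ^+ m.-1) = z - z ^+ m.
  by rewrite mulrBr mulr1 -exprS prednK //; lia.
by rewrite -evM [_ * eval_z _]mulrC -mulrA mulVKr // mulrC.
Qed.

Lemma word_series_t_inv k (g : {fps R}) :
  1 - cluster_series 0 m k = g -> g^-1 = word_series_t 0 m k.
Proof.
move=> <-; have LM := @word_series_tM R 0 m m_gt1 k.
have gU : 1 - cluster_series (0 : R) m k \is a GRing.unit.
  by rewrite fps_unitE fcoefB cluster_series0 // subr0 unitr1.
by apply: (mulIr gU); rewrite mulVr // LM.
Qed.

(** Both numbers are the same coefficient of [t^k]; they are compared in [rat], where naturals
    embed. *)
Lemma dcoef_chains j k : dcoef m j k = chains k.*2.+1 (enr true) (j * m).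
Proof.
by apply/eqP; rewrite -(Num.Theory.eqr_nat rat) -fcoef_chains fcoef_rhoX.
Qed.

Lemma dcoef'_chains j k : dcoef' m j k = chains k.*2.+1 (enr true) (j * m + 1).
Proof.
apply/eqP; rewrite -(Num.Theory.eqr_nat rat) -fcoef_chains fcoef_rhoX Num.Theory.eqr_nat.
by apply/eqP/eq_bigr => l _; rewrite addnA.
Qed.

(** Expand [(1 - X) / (1 - X^m)] into the terms [X^(jm) - X^(jm+1)], then weight each power of [X]
    by its number of chains. *)
Lemma den_sum k i : eventually_const
  (fun N => (\sum_(j < N) ((dcoef m j k)%:R * X ^+ (j * m)
                           - (dcoef' m j k)%:R * X ^+ (j * m + 1))) i)
  ((1 - cluster_series 0 m k) i).
Proof.
exists i.+1 => N iN; set h := (chains k.*2.+1 (enr true) i)%:R : R.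
have -> : (1 - cluster_series 0 m k) i = (1 - cluster 0 m) i * h.
  rewrite !fcoefB fcoef_eval_z mulrBl; congr (_ - _).
  rewrite fcoef1 /h; case: i {h iN} => [|i] /=; last by rewrite mul0r.
  by rewrite -fcoef_chains mulr1 inv1BX mulr1.
have -> : (\sum_(j < N) ((dcoef m j k)%:R * X ^+ (j * m)
     - (dcoef' m j k)%:R * X ^+ (j * m + 1))) i
  = (\sum_(j < N) (X ^+ m) ^+ j * (1 - X)) i * h.
  rewrite !fcoef_sum mulr_suml; apply: eq_bigr => j _.
  rewrite mulrBr mulr1 -exprM -exprSr !fcoefB mulrBl -!fpsC_nat !fcoefCM !fcoefXn.
  rewrite dcoef_chains dcoef'_chains mulnC addn1 /h.
  congr (_ - _); case: eqP => [->|_]; rewrite ?mulr1 ?mul1r ?mulr0 ?mul0r //.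
congr (_ * h); rewrite cluster_s0 -mulr_suml.
(* The remainder of the truncated expansion is divisible by [X^(mN)], and [i < m * N]. *)
have -> : (1 - X) / (1 - X ^+ m) =
    \sum_(j < N) (X ^+ m) ^+ j * (1 - X) + X ^+ (m * N) * ((1 - X) / (1 - X ^+ m)).
  apply: (mulIr oneBXm_unit); rewrite [RHS]mulrDl -[X in _ = _ + X]mulrA.
  rewrite !divrK ?oneBXm_unit //.
  have := subrX1 (X ^+ m) N; rewrite -exprM => geom.
  have -> : X ^+ (m * N) = 1 + (X ^+ m - 1) * \sum_(j < N) (X ^+ m) ^+ j.
    by rewrite -geom; ring.
  by rewrite -mulr_suml; ring.
rewrite -mulr_suml fcoefD fcoefXnM ifT ?addr0 //; nia.
Qed.

Lemma reciprocal_sum k j : eventually_const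
  (fun N => (\sum_(n < N) fpsC (word_series_t 0 m n) * t ^+ n) k j)
  (word_series_t 0 m k j).
Proof.
exists k.+1 => N kN; congr (fcoef _ j).
rewrite fcoef_sum; under eq_bigr do rewrite fcoefCM fcoefXn.
rewrite (bigD1 (Ordinal kN)) // big1 => [|n].
  by rewrite eqxx mulr1; apply: addr0.
by rewrite -val_eqE eq_sym => /negbTE ->; rewrite mulr0.
Qed.
End AvoidingCase.

(** In (a) each coefficient of [t^k x^j] is itself a series in [s], whose limit is again taken
    coefficientwise. *)
Lemma eventually_const_fps (a : nat -> {fps rat}) l :
  eventually_const a l -> is_flim a l.
Proof. by move=> [N aN] i; exists N => n /aN ->. Qed.

(* Formal power series in t over formal power series in x (over formal power
   series in s, in the first part), over the rationals. *)
Theorem theorem4p7 (m : nat) (hm : (2 <= m)%N) :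
  (let s : {fps {fps {fps rat}}} := fpsC (fpsC (fpsX rat)) in
   let x : {fps {fps {fps rat}}} := fpsC (fpsX {fps rat}) in
   let t : {fps {fps {fps rat}}} := fpsX {fps {fps rat}} in
   let u := usub t in
   let z := zsub t x in
   let lhs (n : nat) := Pilpk (incr m) n s u * z ^+ n in
   let f := z / (1 - t)
     + (s - 1) * z ^+ m
       / ((1 - t) * (1 - (s - 1) * \sum_(1 <= l < m) z ^+ l)) in
   [/\ fsummable lhs,
       fsummable (hadamard_exp f)
     & (1 - t)^-1 * fsum lhs = fsum (hadamard_exp f)])
  /\
  (let x : {fps {fps rat}} := fpsC (fpsX rat) in
   let t : {fps {fps rat}} := fpsX {fps rat} in
   let u := usub t in
   let z := zsub t x in
   let lhs (n : nat) := Pilpk0 (incr m) n u * z ^+ n in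
   let f := z * (1 - z ^+ m.-1) / ((1 - t) * (1 - z ^+ m)) in
   [/\ fsummable lhs,
       fsummable (hadamard_exp f)
     & (1 - t)^-1 * fsum lhs = fsum (hadamard_exp f)])
  /\
  (let x : {fps {fps rat}} := fpsC (fpsX rat) in
   let t : {fps {fps rat}} := fpsX {fps rat} in
   let u := usub t in
   let z := zsub t x in
   let lhs (n : nat) := Pilpk0 (incr m) n u * z ^+ n in
   let y : {fps rat} := fpsX rat in
   let den (k j : nat) :=
     (dcoef m j k)%:R * y ^+ (j * m) - (dcoef' m j k)%:R * y ^+ (j * m + 1) in
   let rhs (k : nat) := fpsC (fsum (den k))^-1 * t ^+ k in
   [/\ fsummable lhs,
       forall k, fsummable (den k),
       fsummable rhs
     & (1 - t)^-1 * fsum lhs = fsum rhs]).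
Proof.
have lhs0 : has_fsum
    (fun n => Pilpk0 (incr m) n (usub (fpsX {fps rat})) *
              zsub (fpsX {fps rat}) (fpsC (fpsX rat)) ^+ n)
    ((1 - fpsX {fps rat}) * word_series_t (0 : rat) m).
  (* (b) and (c) share this left side: at [s = 0] the constant [fpsC (fpsC 0)] is 0. *)
  move=> k j; have := Pilpk_sum (0 : rat) hm k j.
  by rewrite !raddf0.
split; last split.
- move=> s x t u z lhs f.
  have lhsP : has_fsum lhs ((1 - t) * word_series_t (fpsX rat) m).
    by move=> k j; apply: eventually_const_fps; apply: (Pilpk_sum (fpsX rat) hm).
  have fP : has_fsum (hadamard_exp f) (word_series_t (fpsX rat) m).
    rewrite /f /z /s cluster_seriesP //.
    by move=> k j; apply: eventually_const_fps; apply: hadamard_sum.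
  split; [by exists ((1 - t) * word_series_t (fpsX rat) m)
         |by exists (word_series_t (fpsX rat) m)|].
  by rewrite (has_fsumE fP) (has_fsumE lhsP) mulKr ?oneBX_unit.
- move=> x t u z lhs f.
  have fP : has_fsum (hadamard_exp f) (word_series_t (0 : rat) m).
    rewrite /f /z cluster_series_s0 //.
    by move=> k j; apply: hadamard_sum.
  split; [by exists ((1 - t) * word_series_t (0 : rat) m)
         |by exists (word_series_t (0 : rat) m)|].
  by rewrite (has_fsumE fP) (has_fsumE lhs0) mulKr ?oneBX_unit.
move=> x t u z lhs y den rhs.
have denP k : has_fsum (den k) (1 - cluster_series (0 : rat) m k).
  exact: den_sum hm k.
have rhsP : has_fsum rhs (word_series_t (0 : rat) m).
  have -> : rhs = fun n => fpsC (word_series_t (0 : rat) m n) * t ^+ n.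
    apply/funext => n; rewrite /rhs; congr (fpsC _ * _).
    by apply: word_series_t_inv => //; rewrite (has_fsumE (denP n)).
  by move=> k j; apply: reciprocal_sum.
split.
- by exists ((1 - t) * word_series_t (0 : rat) m).
- by move=> k; exists (1 - cluster_series (0 : rat) m k).
- by exists (word_series_t (0 : rat) m).
- apply: etrans (congr1 ( *%R (1 - t)^-1) (has_fsumE lhs0)) _.
  exact: etrans (mulKr (oneBX_unit _) _) (esym (has_fsumE rhsP)).
Qed.
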